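(* Let $n\ge 3$ and let $\tau$ be a rooted binary tree with $n$ labeled leaves (labeled $1,\dots,n$). For each internal vertex $v$ of $\tau$, let $d(v)$ be the number of internal vertices of $\tau$ which are descendants of $v$, including $v$. Let $C(\tau)$ be the coarse cell of $\mathcal{B}(K_n)$ corresponding to the tree $\tau$. There are exactly $$\frac{(n-1)!}{\prod_v d(v)}$$ full-dimensional fine cells in $C(\tau)$, where the product is over all internal vertices $v$ of $\tau$.
   Context: $M(K_n)$ is the graphic matroid of the complete graph $K_n$ on vertices $1,\dots,n$, with ground set the edge set $E$, $|E|=\binom n2$. For a matroid $M$ on $E$, $\omega\in\mathbb{R}^E$ and a circuit $C$, $\operatorname{in}_\omega(C)$ is the set of elements of $C$ of largest $\omega$-weight among elements of $C$, and $M_\omega$ is the matroid whose circuits are the inclusion-minimal members of $\{\operatorname{in}_\omega(C): C\text{ a circuit of }M\}$. With $S=\{\omega\in\mathbb{R}^E:\sum_e\omega_e=0,\ \sum_e\omega_e^2=1\}$, $M=M(K_n)$, the Bergman fan is $\widetilde{\mathcal{B}}(K_n)=\{\omega\in\mathbb{R}^E: M_\omega\text{ has no loops}\}$ and the Bergman complex is $\mathcal{B}(K_n)=\widetilde{\mathcal{B}}(K_n)\cap S$. For $\omega\in\mathbb{R}^E$, $\mathcal{F}(\omega)$ is the unique flag $\emptyset=F_0\subset F_1\subset\dots\subset F_k\subset F_{k+1}=E$ (strict inclusions) such that $\omega$ is constant on each $F_i\setminus F_{i-1}$ and $\omega|_{F_i\setminus F_{i-1}}<\omega|_{F_{i+1}\setminus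 F_i}$. Fine cells of $\mathcal{B}(K_n)$: classes of $u\sim v$ iff $\mathcal{F}(u)=\mathcal{F}(v)$. Coarse cells: classes of $u\sim v$ iff $M_u=M_v$. Each fine cell is contained in a unique coarse cell. Full-dimensional cells are those of maximal dimension, $\dim\mathcal{B}(K_n)=n-3$. An equidistant $n$-tree is a rooted tree with leaves labeled $1,\dots,n$ (each internal vertex, including the root, having at least two children), with real edge lengths such that all leaves are at the same total distance from the root, internal edges having positive lengths and leaf edges arbitrary real lengths. Its distance vector has entries $d_{ij}$, the length of the path joining leaves $i$ and $j$, regarded as a weight on the edges of $K_n$. It is known that the assignment of distance vectors is a bijection from equidistant $n$-trees onto $\widetilde{\mathcal{B}}(K_n)$, and that two points lie in the same coarse cell iff their trees have the same combinatorial type (underlying leaf-labeled rooted tree). $C(\tau)$ is the set of points of $\mathcal{B}(K_n)$ whose tree has combinatorial type $\tau$. In a rooted binary tree every internal vertex has exactly two children. *)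

(* Defs.v *)
From HB Require Import structures.
From mathcomp Require Import all_boot all_order all_algebra.
From mathcomp Require Import all_classical reals.

Set Implicit Arguments.
Unset Strict Implicit.
Unset Printing Implicit Defensive.

Import Order.TTheory GRing.Theory Num.Theory.

Local Open Scope classical_set_scope.
Local Open Scope ring_scope.

(* A matroid on E is represented by its set of circuits, [set {set E}]. *)
Section InitialMatroid.
Variables (R : realType) (E : finType).
Implicit Types (w : {ffun E -> R^o}) (M : set {set E}).

Definition initial w (C : {set E}) : {set E} :=
  [set e in C | [forall f in C, w f <= w e]]%SET.

Definition initial_sets w M : set {set E} := [set initial w C | C in M].

Definition initial_matroid w M : set {set E} :=
  [set D | initial_sets w M D /\
     forall D', initial_sets w M D' -> D' \subset D -> D' = D].

Definition loopless M : Prop := forall e : E, ~ M [set e]%SET.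

Definition bergman_fan M : set {ffun E -> R^o} :=
  [set w | loopless (initial_matroid w M)].

Definition bergman_complex M : set {ffun E -> R^o} :=
  [set w | [/\ bergman_fan M w, \sum_e w e = 0 & \sum_e w e ^+ 2 = 1]].

(* [is_flag w F] : F_0 :: F is the flag F(w), where F_0 is the empty set;
   the steps F_i \ F_(i-1) are indexed from 0. *)
Definition step (F : seq {set E}) (i : nat) : {set E} :=
  (nth finset.set0 F i :\: nth finset.set0 (finset.set0 :: F) i)%SET.

Definition is_flag w (F : seq {set E}) : Prop :=
  [/\ path (fun A B : {set E} => A \proper B) finset.set0 F,
      last finset.set0 F = [set: E]%SET,
      forall i, (i < size F)%N ->
        {in step F i &, forall e f, w e = w f} &
      forall i, (i.+1 < size F)%N ->
        {in step F i & step F i.+1, forall e f, w e < w f}].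

Definition same_flag w w' : Prop := exists2 F, is_flag w F & is_flag w' F.

Definition fine_cell M (c : set {ffun E -> R^o}) : Prop :=
  exists2 w, bergman_complex M w &
    c = [set w' | bergman_complex M w' /\ same_flag w w'].

(* A cell is a relatively open subset of the unit sphere of a linear subspace,
   so its dimension is one less than that of its linear span, i.e. than the
   largest number of linearly independent points it contains. *)
Definition cell_dim (c : set {ffun E -> R^o}) : nat :=
  (\max_(k < (\dim {: {ffun E -> R^o}}).+1 |
      `[< exists s : k.-tuple {ffun E -> R^o},
            free s /\ forall w, w \in s -> c w >]) k).-1.

Definition full_dimensional M (c : set {ffun E -> R^o}) : Prop :=
  forall c', fine_cell M c' -> (cell_dim c' <= cell_dim c)%N.

End InitialMatroid.

Definition edge (n : nat) : finType := {e : {set 'I_n} | #|e| == 2}.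

Definition cycle_edges n (s : seq 'I_n) : {set edge n} :=
  [set e : edge n | [exists x in s, val e == [set x; next s x]%SET]]%SET.

(* The circuits of M(K_n). *)
Definition graphic_Kn (n : nat) : set {set edge n} :=
  [set cycle_edges s | s in [set s : seq 'I_n | uniq s /\ (2 < size s)%N]].
Arguments graphic_Kn n _ : clear implicits.

(* Rooted trees are encoded by a parent map, fixing the root; the tree edges
   are the pairs {v, parent v} with v different from the root. *)
Definition children (V : finType) (root : V) (parent : V -> V) (v : V) :
  {set V} := [set u | (u != root) && (parent u == v)]%SET.

Record labeled_tree (n : nat) := LabeledTree {
  vertex :> finType;
  tree_root : vertex;
  parent : vertex -> vertex;
  leaf : 'I_n -> vertex;
  parent_root : parent tree_root = tree_root;
  root_ancestor : forall v, exists k, iter k parent v = tree_root;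
  leaf_inj : injective leaf;
  leafP : forall v, (children tree_root parent v == finset.set0) = (v \in codom leaf);
  branching : forall v, v \notin codom leaf ->
    (1 < #|children tree_root parent v|)%N
}.

Section Trees.
Variables (n : nat) (t : labeled_tree n).

Definition internal (v : t) : bool := v \notin codom (@leaf n t).

Definition binary : Prop :=
  forall v : t, internal v -> #|children (tree_root t) (@parent n t) v| = 2.

Definition descendant (v u : t) : bool := fconnect (@parent n t) u v.

Definition num_internal_desc (v : t) : nat :=
  #|[set u : t | internal u && descendant v u]%SET|.

Definition adjacent (x y : t) : bool :=
  (x != y) && ((parent x == y) || (parent y == x)).

Section Lengths.
Variable R : realType.
(* [len v] is the length of the edge {v, parent v}; [len (tree_root t)] is unused. *)
Variable len : t -> R.

Definition edge_length (x y : t) : R :=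
  if parent x == y then len x else len y.

Fixpoint path_length (x : t) (p : seq t) : R :=
  if p is y :: p' then edge_length x y + path_length y p' else 0.

Definition is_distance (x y : t) (d : R) : Prop :=
  exists p : seq t,
    [/\ path adjacent x p, uniq (x :: p), last x p = y & path_length x p = d].

Definition equidistant : Prop :=
  (forall v : t, v != tree_root t -> internal v -> 0 < len v) /\
  (exists h : R, forall i : 'I_n, is_distance (tree_root t) (leaf t i) h).

Definition is_distance_vector (w : {ffun edge n -> R^o}) : Prop :=
  forall (e : edge n) (i j : 'I_n), val e = [set i; j]%SET ->
    is_distance (leaf t i) (leaf t j) (w e).

End Lengths.

(* An equidistant tree of combinatorial type t is t with edge lengths. *)
Definition tree_cell (R : realType) : set {ffun edge n -> R^o} :=
  [set w | bergman_complex (graphic_Kn n) w /\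
     exists len : t -> R, equidistant len /\ is_distance_vector len w].

End Trees.

Arguments tree_cell {n} t R _.

(* Main.v *)
Require Import Defs.
From mathcomp Require Import all_boot all_order all_algebra.
From mathcomp Require Import all_classical reals.
From mathcomp Require Import ring.

(** A point of the Bergman complex of M(K_n) is an ultrametric, that is, a
    weight that satisfies the strong triangle inequality on every triangle.
    Such a weight lies in C(tau) exactly when the weight of the edge ij is
    H (lca i j), where lca i j is the lowest common ancestor of the leaves i
    and j, and H is a function on the internal vertices that strictly increases
    towards the root ([tree_cellP]): H v is twice the height of v above the
    leaves.

    A fine cell remembers only the weak ordering of the edges by weight
    ([same_flagP]). If a weight takes k values, then its fine cell has dimension
    at most k - 2, because the conditions of summing to zero and having norm
    one each cost a dimension ([cell_dim_same_order]). An ultrametric on n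
    points takes at most n - 1 values ([values_bounded]), and when it takes
    n - 1 of them the bound is an equality ([order_cell_dim]). A binary tree
    with n leaves has n - 1 internal vertices, so that the full-dimensional
    fine cells in C(tau) are those on which H is injective. Such a cell amounts
    to listing the internal vertices by decreasing H, with each vertex after
    its ancestors; conversely every such list is realized ([order_cell] is the
    cell of a list). Hence the cells correspond to the linear extensions of the
    forest order on the internal vertices.

    Linear extensions of a forest of size m satisfy the hook length formula
    m! / prod_v d(v) ([size_linexts]). It follows by induction from the choice
    of the first vertex r, which is a root of the forest: removing r leaves
    every other d(v) unchanged, and the numbers d(r), over the roots r, add
    up to m. *)

Import Order.TTheory GRing.Theory Num.Theory.
Local Open Scope classical_set_scope.
Local Open Scope card_scope.
Local Open Scope ring_scope.

Set Implicit Arguments.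
Unset Strict Implicit.
Unset Printing Implicit Defensive.

(** * Hook length formula for linear extensions of a forest *)

Section LinearExtensions.
Variables (T : finType) (le : rel T).
Hypotheses (le_refl : reflexive le) (le_anti : antisymmetric le)
  (le_trans : transitive le)
  (le_chain : forall x y z, le x y -> le x z -> le y z || le z y).
Implicit Types (A : {set T}) (s : seq T) (u v r : T).

Definition maxima A : {set T} :=
  [set r in A | [forall v in A, le r v ==> (v == r)]]%SET.

Definition down A v : {set T} := [set u in A | le u v]%SET.

(** The orderings of a set with [m] elements in which no element precedes
    anything above it: the head is a maximal element. An explicit list makes
    both the recursion on the head and the count immediate. *)
Fixpoint linexts m A : seq (seq T) :=
  if m is m'.+1 then
    [seq r :: s | r <- enum (maxima A), s <- linexts m' (A :\ r)%SET]
  else [:: [::]].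

Definition is_linext A s : Prop :=
  [/\ uniq s, s =i A & {in A &, forall u v, le u v -> (index v s <= index u s)%N}].

Lemma maximaP A r :
  reflect (r \in A /\ forall v, v \in A -> le r v -> v = r) (r \in maxima A).
Proof.
rewrite inE; apply: (iffP andP) => -[rA].
  by move=> /forall_inP rmax; split=> // v vA /(implyP (rmax v vA))/eqP.
move=> rmax; split=> //; apply/forall_inP => v vA; apply/implyP => rv.
by apply/eqP/rmax.
Qed.

Lemma maxima_above A u : u \in A -> exists2 r, r \in maxima A & le u r.
Proof.
move=> uA; have uu : (u \in A) && le u u by rewrite uA le_refl.
case: (@arg_maxnP _ u (fun v => (v \in A) && le u v) (fun v => #|down A v|) uu).
move=> r /andP[rA ur] rmax; exists r => //; apply/maximaP; split=> // v vA rv.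
have uv : le u v := le_trans ur rv.
have := rmax v; rewrite vA uv => /(_ isT) le_card.
have sub : down A r \subset down A v.
  by apply/fintype.subsetP => x; rewrite !inE => /andP[-> xr]; apply: le_trans rv.
have eqd : down A r = down A v by apply/eqP; rewrite eqEcard sub; exact: le_card.
have : v \in down A v by rewrite !inE vA le_refl.
by rewrite -eqd !inE vA /= => vr; apply: le_anti; rewrite vr rv.
Qed.

(** This is where the forest condition enters: the elements above [u] form a
    chain, which has at most one maximal element. *)
Lemma maxima_unique A u r r' :
  r \in maxima A -> r' \in maxima A -> le u r -> le u r' -> r = r'.
Proof.
move=> /maximaP[rA rmax] /maximaP[rA' rmax'] ur ur'.
by case/orP: (le_chain ur ur') => [/(rmax _ rA')|/(rmax' _ rA)].
Qed.

(** Each element lies in the down-set of exactly one maximal element, so the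
    trees of a forest partition it. *)
Lemma sum_card_down_maxima A : (\sum_(r in maxima A) #|down A r| = #|A|)%N.
Proof.
under eq_bigr => r _ do rewrite -sum1_card.
rewrite (exchange_big_dep (mem A)) /=; last by move=> r u _; rewrite inE => /andP[].
rewrite -sum1_card; apply: eq_bigr => u uA.
have [r rmax ur] := maxima_above uA.
rewrite (big_pred1 r) // => r'; rewrite /= !inE uA /= -[r' \in A as X in X && _]/(_).
apply/idP/eqP => [/andP[r'max ur']|->]; last by move: rmax; rewrite inE ur andbT.
by apply: (@maxima_unique A u) => //; rewrite inE.
Qed.

(** A maximal element lies in no down-set but its own, so that removing it
    leaves the hook lengths of the others unchanged. *)
Lemma down_remove A r v : r \in maxima A -> v \in (A :\ r)%SET ->
  down (A :\ r)%SET v = down A v.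
Proof.
move=> /maximaP[rA rmax]; rewrite !inE => /andP[vr vA].
apply/setP => u; rewrite !inE; case: (eqVneq u r) => //= ->.
by apply/esym/negP => /andP[_ /(rmax _ vA) e]; rewrite e eqxx in vr.
Qed.

(** Hook length formula, by induction on the size of [A]: the lists with head
    [r] number [(#|A| - 1)! * d(r) / prod_v d(v)], and the [d(r)] add up to
    [#|A|]. *)
Lemma size_linexts A :
  (size (linexts #|A| A) * \prod_(v in A) #|down A v| = (#|A|)`!)%N.
Proof.
move: {2}#|A| (erefl #|A|) => m.
elim: m A => [|m IHm] A cardA; rewrite cardA.
  have -> : A = finset.set0 by apply/eqP; rewrite -cards_eq0 cardA.
  by rewrite big_set0.
rewrite /= size_allpairs_dep factS -{1}cardA -sum_card_down_maxima.
rewrite sumnE big_map big_enum /= !big_distrl /=; apply: eq_bigr => r rmax.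
have rA : r \in A by case/maximaP: rmax.
have card' : #|(A :\ r)%SET| = m.
  by move: cardA; rewrite (cardsD1 r) rA add1n => -[].
have := IHm _ card'; rewrite card' => <-.
rewrite (big_setD1 r) //= mulnCA; congr (_ * (_ * _))%N.
by apply: eq_bigr => v /(down_remove rmax) ->.
Qed.

Lemma uniq_linexts m A : uniq (linexts m A).
Proof.
elim: m A => //= m IHm A; apply: allpairs_uniq_dep; first exact: enum_uniq.
  by move=> r _; apply: IHm.
by move=> [r s] [r' s'] _ _ /= [-> ->].
Qed.

Lemma linextsP m A s : #|A| = m -> s \in linexts m A <-> is_linext A s.
Proof.
elim: m A s => [|m IHm] A s cardA.
  have -> : A = finset.set0 by apply/eqP; rewrite -cards_eq0 cardA.
  rewrite inE; split=> [/eqP->|[_ s0 _]].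
    by split=> // u; rewrite !inE.
  by case: s s0 => // x s /(_ x); rewrite !inE eqxx.
have card' r : r \in A -> #|(A :\ r)%SET| = m.
  by move=> rA; move: cardA; rewrite (cardsD1 r) rA add1n => -[].
split=> [/allpairsPdep[r [s' [rmax s'ext ->]]]|].
  move: rmax; rewrite mem_enum => /maximaP[rA rmax].
  have [s'_uniq s'A s'le] := (IHm _ _ (card' r rA)).1 s'ext.
  split=> [|u|u v uA vA uv] /=.
  - by rewrite s'A !inE eqxx.
  - by rewrite in_cons s'A !inE; case: eqVneq => // ->.
  - case: (eqVneq r v) => // rv; case: (eqVneq r u) => [ru|ru].
      by move: rv; rewrite [v]rmax ?eqxx // ru.
    by rewrite ltnS s'le // !inE eq_sym ?rv ?ru.
case: s => [|r s] [s_uniq sA sle].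
  by have A0 : #|A| = 0%N by [apply: eq_card0 => u; rewrite -sA]; rewrite A0 in cardA.
move: s_uniq => /= /andP[rs s_uniq].
have rA : r \in A by rewrite -sA mem_head.
have s'A u : (u \in s) = (u \in (A :\ r)%SET).
  by rewrite !inE -sA in_cons; case: eqVneq => //= ->; apply/negbTE.
apply/allpairsPdep; exists r, s; split=> //; last first.
  apply/(IHm _ _ (card' r rA)); split=> // u v; rewrite !inE => /andP[ur uA].
  move=> /andP[vr vA] /(sle u v uA vA) /=.
  by rewrite eq_sym (negbTE vr) eq_sym (negbTE ur).
rewrite mem_enum; apply/maximaP; split=> // v vA /(sle r v rA vA) /=.
by rewrite eqxx; case: (eqVneq r v).
Qed.

End LinearExtensions.

(** * Flags and weak orderings *)

Section Flags.
Variables (R : realType) (E : finType).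
Implicit Types (w : {ffun E -> R^o}) (F : seq {set E}) (e f g : E).

Definition same_order w w' : Prop := forall e f, (w e <= w f) = (w' e <= w' f).

Definition values w : seq R := sort <=%R (undup (codom w)).

Definition level w e : nat := index (w e) (values w).

Lemma mem_values w c : (c \in values w) = (c \in codom w).
Proof. by rewrite mem_sort mem_undup. Qed.

Lemma values_uniq w : uniq (values w).
Proof. by rewrite sort_uniq undup_uniq. Qed.

Lemma level_ltn w e : (level w e < size (values w))%N.
Proof. by rewrite index_mem mem_values codom_f. Qed.

Lemma level_leq w e f : (level w e <= level w f)%N = (w e <= w f).
Proof.
have srt : sorted <%R (values w) by rewrite sort_lt_sorted undup_uniq.
have := @lt_sorted_leq_nth _ _ 0 _ srt (level w e) (level w f).
rewrite !inE !level_ltn => /(_ isT isT) <-.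
by rewrite !nth_index ?mem_values ?codom_f.
Qed.

Lemma level_surj w i : (i < size (values w))%N -> exists e, level w e = i.
Proof.
move=> ilt; have := mem_nth 0 ilt; rewrite mem_values => /codomP[e we].
by exists e; rewrite /level -we index_uniq // values_uniq.
Qed.

Definition level_flag w : seq {set E} :=
  mkseq (fun i => [set e | level w e <= i]%N%SET) (size (values w)).

Lemma step_level_flag w i : (i < size (values w))%N ->
  step (level_flag w) i = [set e | level w e == i]%SET.
Proof.
move=> ilt; apply/setP => e; rewrite /step !inE nth_mkseq // inE.
case: i ilt => [|i] ilt /=; first by rewrite inE leqn0.
by rewrite nth_mkseq ?(ltnW ilt) // !inE -ltnNge eqn_leq andbC.
Qed.

Lemma is_flag_level_flag w : is_flag w (level_flag w).
Proof.
split.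
- apply/(pathP finset.set0) => i; rewrite size_mkseq => ilt.
  rewrite nth_mkseq //; have [e le] := level_surj ilt; apply/properP; split.
    case: i ilt le => [|i] ilt _ /=; first by rewrite finset.sub0set.
    by rewrite nth_mkseq ?(ltnW ilt) //; apply/fintype.subsetP => f; rewrite !inE => /leqW.
  exists e; rewrite ?inE ?le //; case: i ilt le => [|i] ilt le /=; rewrite ?inE //.
  by rewrite nth_mkseq ?(ltnW ilt) // inE le ltnn.
- apply/setP => e; rewrite (last_nth finset.set0) size_mkseq.
  case sz: (size (values w)) (level_ltn w e) => [|m] //= lm.
  by rewrite nth_mkseq ?sz // !inE -ltnS.
- move=> i; rewrite size_mkseq => ilt e f.
  rewrite step_level_flag // !inE => /eqP le /eqP lf.
  by apply/eqP; rewrite eq_le -!level_leq le lf leqnn.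
- move=> i; rewrite size_mkseq => ilt e f.
  rewrite !step_level_flag ?(ltnW ilt) // !inE => /eqP le /eqP lf.
  by rewrite ltNge -level_leq le lf ltnn.
Qed.

(** The defining conditions of a flag mention [w] only through comparisons of
    two weights. *)
Lemma is_flag_same_order w w' F : same_order w w' -> is_flag w F -> is_flag w' F.
Proof.
move=> ww' [Fpath Flast Feq Flt]; split=> // i ilt e f ei fi.
  by apply/eqP; rewrite eq_le -!ww' -eq_le; apply/eqP/(Feq i).
by rewrite ltNge -ww' -ltNge (Flt i).
Qed.

Definition flag_index F e : nat := find (fun A : {set E} => e \in A) F.

Lemma flag_index_ltn w F e : is_flag w F -> (flag_index F e < size F)%N.
Proof.
case=> _ Flast _ _; rewrite -has_find; apply/hasP.
exists (last finset.set0 F); last by rewrite Flast inE.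
case: F Flast => [/setP/(_ e)|A F _]; first by rewrite !inE.
by rewrite /= mem_last.
Qed.

Lemma mem_step_flag_index w F e : is_flag w F -> e \in step F (flag_index F e).
Proof.
move=> wF; have := flag_index_ltn e wF; rewrite -has_find.
move=> /(nth_find finset.set0) /= ein; rewrite inE ein andbT.
have := @before_find _ finset.set0 (fun A : {set E} => e \in A) F.
rewrite -/(flag_index F e); case: (flag_index F e) => [|i] bef /=.
  by rewrite inE.
by rewrite bef.
Qed.

(** A flag compares consecutive steps only. Steps are nonempty, because the
    inclusions are strict, so the comparison extends by transitivity. *)
Lemma flag_step_lt w F i j e f : is_flag w F -> (i < j < size F)%N ->
  e \in step F i -> f \in step F j -> w e < w f.
Proof.
case=> /(pathP finset.set0) Fpath _ _ Flt.
elim: j f => // j IHj f; rewrite ltnS => /andP[ij jlt] ei fj.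
move: ij; rewrite leq_eqVlt => /predU1P[eij|ij].
  by apply: (Flt j) => //; rewrite -eij.
have [_ [g gj gj']] := properP (Fpath j (ltnW jlt)).
have gstep : g \in step F j by rewrite inE gj gj'.
by apply: lt_trans (Flt j jlt g f gstep fj); apply: IHj; rewrite // ij ltnW.
Qed.

Lemma flag_index_leq w F e f : is_flag w F ->
  (w e <= w f) = (flag_index F e <= flag_index F f)%N.
Proof.
move=> wF; have [es fs] := (mem_step_flag_index e wF, mem_step_flag_index f wF).
have [elt flt] := (flag_index_ltn e wF, flag_index_ltn f wF).
case: (ltngtP (flag_index F e) (flag_index F f)) => [ef|fe|ef].
- by rewrite ltW // (flag_step_lt wF _ es fs) // ef.
- by rewrite leNgt (flag_step_lt wF _ fs es) // fe.
- case: wF => _ _ Feq _; rewrite (Feq _ flt e f) ?lexx // -ef //.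
Qed.

(** A flag determines the ordering of the edges by the index of the step that
    contains them, and conversely the sublevel sets of [w] form a flag. *)
Lemma same_flagP w w' : same_flag w w' <-> same_order w w'.
Proof.
split=> [[F wF w'F] e f|ww'].
  by rewrite (flag_index_leq _ _ wF) (flag_index_leq _ _ w'F).
have wF := is_flag_level_flag w.
by exists (level_flag w) => //; apply: is_flag_same_order wF.
Qed.

End Flags.

(** * The Bergman fan of the complete graph *)

Section CompleteGraph.
Variables (R : realType) (n : nat).
Implicit Types (w : {ffun edge n -> R^o}) (e f : edge n) (i j k : 'I_n).

Lemma edge_neq e i j : val e = [set i; j]%SET -> i != j.
Proof. by move=> ve; have := valP e; rewrite ve cards2; case: (i != j). Qed.

Lemma edge_ends e : exists i j, val e = [set i; j]%SET.
Proof. by have /cards2P[i [j [_ ->]]] := valP e; exists i, j. Qed.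

Lemma ex_edge i j : i != j -> exists e, val e = [set i; j]%SET.
Proof.
move=> ij; have c2 : #|[set i; j]%SET| == 2 by rewrite cards2 ij.
by exists (Sub [set i; j]%SET c2); rewrite SubK.
Qed.

Lemma edge_other_end e i : i \in val e -> exists j, val e = [set i; j]%SET.
Proof.
have [j [k ->]] := edge_ends e; rewrite !inE => /orP[]/eqP->; first by exists k.
by exists j; rewrite finset.setUC.
Qed.

Lemma mem_cycle_edges s e :
  reflect (exists2 x, x \in s & val e = [set x; next s x]%SET)
          (e \in cycle_edges s).
Proof.
rewrite inE; apply: (iffP existsP) => -[x].
  by move=> /andP[xs /eqP]; exists x.
by move=> xs ve; exists x; rewrite xs ve /=.
Qed.

Lemma next_neq (s : seq 'I_n) x : uniq s -> (1 < size s)%N -> x \in s -> x != next s x.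
Proof.
move=> s_uniq s_size xs; have [i s' def_s] := rot_to xs.
rewrite -(next_rot i s_uniq) def_s; move: s_uniq s_size.
rewrite -(rot_uniq i) -(size_rot i) def_s.
by case: s' {def_s} => // y s' /= /andP[]; rewrite inE eqxx negb_or => /andP[].
Qed.

Lemma cycle_edges_neq0 (s : seq 'I_n) : uniq s -> (2 < size s)%N ->
  cycle_edges s != finset.set0.
Proof.
case: s => // x s s_uniq s_size; have xs : x \in x :: s by exact: mem_head.
have [e ve] := ex_edge (next_neq s_uniq (ltnW s_size) xs).
by apply/set0Pn; exists e; apply/mem_cycle_edges; exists x.
Qed.

End CompleteGraph.

Section Loopless.
Variables (R : realType) (E : finType).
Implicit Types (w : {ffun E -> R^o}) (C : {set E}) (e : E).

Lemma mem_initial w C e :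
  reflect (e \in C /\ forall f, f \in C -> w f <= w e) (e \in initial w C).
Proof. by rewrite inE; apply: (iffP andP) => -[eC /forall_inP]. Qed.

Lemma initial_neq0 w C : C != finset.set0 -> initial w C != finset.set0.
Proof.
case/set0Pn => e0 e0C; apply/set0Pn.
have [e eC emax] := arg_maxP w e0C.
by exists e; apply/mem_initial.
Qed.

(** An initial form of a circuit is never empty, so a one-element initial form
    is automatically minimal. *)
Lemma looplessP w (M : set {set E}) : (forall C, M C -> C != finset.set0) ->
  loopless (initial_matroid w M) <->
  (forall C e, M C -> initial w C <> [set e]%SET).
Proof.
move=> M0; split=> [lM C e MC Ce|iM e [[C MC Ce] _]]; last exact: iM Ce.
apply: (lM e); split=> [|D [C' MC' <-]]; first by exists C.
rewrite subset1 => /orP[/eqP//|]; by rewrite (negbTE (initial_neq0 w (M0 _ MC'))).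
Qed.

End Loopless.

Section Ultrametrics.
Variables (R : realType) (n : nat).
Implicit Types (w : {ffun edge n -> R^o}) (e f : edge n) (i j k : 'I_n).

Definition ultrametric w : Prop := forall i j k e1 e2 e3,
  val e1 = [set i; j]%SET -> val e2 = [set j; k]%SET -> val e3 = [set i; k]%SET ->
  w e3 <= Num.max (w e1) (w e2).

(** If one side of a triangle outweighs both others, then that side alone is
    the initial form of the triangle, hence a loop. *)
Lemma bergman_fan_ultrametric w :
  bergman_fan (graphic_Kn n) w -> ultrametric w.
Proof.
move/looplessP => iM i j k e1 e2 e3 v1 v2 v3; rewrite leNgt; apply/negP.
rewrite gt_max => /andP[lt1 lt2].
have [ij jk ik] := And3 (edge_neq v1) (edge_neq v2) (edge_neq v3).
have s_uniq : uniq [:: i; j; k] by rewrite /= !inE negb_or ij jk ik.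
apply: (iM _ (cycle_edges [:: i; j; k]) e3).
- by move=> _ [s [? ?] <-]; apply: cycle_edges_neq0.
- by exists [:: i; j; k].
have cycleE f : (f \in cycle_edges [:: i; j; k]) = [|| f == e1, f == e2 | f == e3].
  have valE (a b : edge n) : (a == b) = (val a == val b) by rewrite val_eqE.
  have nxi : next [:: i; j; k] i = j by rewrite /= eqxx.
  have nxj : next [:: i; j; k] j = k by rewrite /= (eq_sym j) (negbTE ij) eqxx.
  have nxk : next [:: i; j; k] k = i.
    by rewrite /= !(eq_sym k) (negbTE ik) (negbTE jk) eqxx.
  rewrite !valE v1 v2 v3 (finset.setUC [set i]%SET [set k]%SET).
  apply/mem_cycle_edges/or3P => [[x]|].
    rewrite !inE => /or3P[]/eqP-> ->; rewrite ?nxi ?nxj ?nxk eqxx;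
      by [constructor 1|constructor 2|constructor 3].
  case=> /eqP->; [exists i|exists j|exists k]; rewrite ?nxi ?nxj ?nxk //;
    by rewrite !inE eqxx ?orbT.
apply/setP => f; rewrite inE; apply/mem_initial/eqP => [|->].
  rewrite cycleE => -[/or3P[]/eqP-> // /(_ e3)]; rewrite cycleE eqxx !orbT => /(_ isT).
    by rewrite leNgt lt1.
  by rewrite leNgt lt2.
rewrite cycleE eqxx !orbT; split=> // g.
by rewrite cycleE => /or3P[]/eqP->; rewrite ?lexx // ltW.
Qed.

(** A pair [i = j] is the end set of no edge, so that the relation is reflexive
    and paths with repeated points need no separate treatment. *)
Definition closer w (c : R) : rel 'I_n :=
  fun i j => [forall e : edge n, (val e == [set i; j]%SET) ==> (w e < c)].

Lemma closerP w c i j :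
  reflect (forall e, val e = [set i; j]%SET -> w e < c) (closer w c i j).
Proof.
apply: (iffP forallP) => cl e; first by move=> /eqP; apply/implyP.
by apply/implyP => /eqP/cl.
Qed.

Lemma closer_trans w c : ultrametric w -> transitive (closer w c).
Proof.
move=> um j i k; case: (eqVneq i j) => [->//|ij]; case: (eqVneq j k) => [->//|jk].
have [[e1 v1] [e2 v2]] := (ex_edge ij, ex_edge jk).
move=> /closerP/(_ e1 v1) lt1 /closerP/(_ e2 v2) lt2; apply/closerP => e v.
by apply: le_lt_trans (um _ _ _ _ _ _ v1 v2 v) _; rewrite gt_max lt1 lt2.
Qed.

(** If [e] were the only heaviest edge of a cycle, the rest of the cycle would
    join the ends of [e] by edges lighter than [e]; the strong triangle
    inequality along this path would make [e] lighter than itself. *)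
Lemma ultrametric_bergman_fan w :
  ultrametric w -> bergman_fan (graphic_Kn n) w.
Proof.
move=> um; apply/looplessP => [_ [s [s_uniq s_size] <-]|_ e [s [s_uniq s_size] <-] Ce].
  exact: cycle_edges_neq0.
have : e \in initial w (cycle_edges s) by rewrite Ce set11.
case/mem_initial => /mem_cycle_edges[x xs ve] emax.
have lt_e f : f \in cycle_edges s -> f != e -> w f < w e.
  move=> fC fe; rewrite lt_neqAle emax // andbT; apply: contra fe => /eqP fe.
  by rewrite -finset.in_set1 -Ce; apply/mem_initial; split=> // g /emax; rewrite fe.
(* Rotate the cycle so that the heaviest edge joins its first two points. *)
have [i s' def_s] := rot_to xs.
have s1_uniq : uniq (x :: s') by rewrite -def_s rot_uniq.
have s1_size : (2 < size (x :: s'))%N by rewrite -def_s size_rot.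
have s_next z : next s z = next (x :: s') z by rewrite -def_s next_rot.
have s_mem z : (z \in s) = (z \in x :: s') by rewrite -def_s mem_rot.
case: s' => [//|y [//|q p]] in def_s s1_uniq s1_size s_next s_mem.
have nx : next s x = y by rewrite s_next /= eqxx.
have ny : next s y = q.
  rewrite s_next /=; move: s1_uniq => /= /andP[]; rewrite inE negb_or eq_sym.
  by move=> /andP[/negbTE-> _] _; rewrite eqxx.
have qx : q != x.
  by case/andP: s1_uniq; rewrite !inE !negb_or => /and3P[_ xq _] _; rewrite eq_sym.
have closer_next z : z \in [:: y, q & p] -> closer w (w e) z (next s z).
  move=> zs; apply/closerP => f vf; apply: lt_e.
    by apply/mem_cycle_edges; exists z; rewrite ?s_mem // inE zs orbT.
  apply: contraTneq zs => fe; move: vf; rewrite fe ve nx => /setP vz.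
  have zxy : z \in [set x; y]%SET by rewrite vz !inE eqxx.
  have xz : x \in [set z; next s z]%SET by rewrite -vz !inE eqxx.
  have xnotin : x \notin [:: y, q & p] by case/andP: s1_uniq.
  case/set2P: zxy => [->//|zy]; case/set2P: xz => [<-//|].
  by rewrite zy ny => xq; rewrite xq eqxx in qx.
have := cycle_next s1_uniq; rewrite /cycle rcons_path => /andP[/andP[_ pth] lst].
have lastin : last y (q :: p) \in [:: y, q & p] by exact: mem_last.
have to_last : closer w (w e) y (last y (q :: p)).
  suff pth' : path (closer w (w e)) y (q :: p).
    by have /allP := order_path_min (closer_trans um) pth'; apply; apply: (mem_last q p).
  have next_closer : {in mem [:: y, q & p] &,
      subrel (frel (next [:: x, y, q & p])) (closer w (w e))}.
    move=> a b ain _ nab; have <- : next s a = b by rewrite s_next; apply/eqP.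
    exact: closer_next.
  exact: (sub_in_path next_closer (x := y) (s := q :: p) (introT allP _) pth).
have to_x : closer w (w e) (last y (q :: p)) x.
  have <- : next s (last y (q :: p)) = x by rewrite s_next; apply/eqP.
  exact: closer_next.
have /closerP/(_ e) := closer_trans um to_last to_x.
by rewrite ve nx finset.setUC ltxx => /(_ erefl).
Qed.

(** Adding a point [x] to a set adds at most one value, the smallest weight
    [w e0] of an edge at [x]: if [e0] joins [x] to [z] and [e] joins [x] to [t]
    with a larger weight, then the triangle [x z t] forces [e] to have the
    weight of the old edge [z t]. *)
Lemma values_bounded w (S : {set 'I_n}) : ultrametric w -> S != finset.set0 ->
  exists2 L : seq R, (size L < #|S|)%N &
    forall e, val e \subset S -> w e \in L.
Proof.
move=> um; move: {2}#|S| (erefl #|S|) => m.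
elim: m S => [|m IHm] S cardS S0; first by rewrite -cards_eq0 cardS in S0.
have /set0Pn[x xS] := S0.
have cardS' : #|(S :\ x)%SET| = m by move: cardS; rewrite (cardsD1 x) xS => -[].
have [S'0|S'0] := eqVneq (S :\ x)%SET finset.set0.
  exists [::] => [|e eS]; first by rewrite cardS.
  have := subset_leq_card eS; rewrite (eqP (valP e)) cardS -cardS' S'0.
  by rewrite cards0.
have [L' sizeL' memL'] := IHm _ cardS' S'0.
have [y] := set0Pn _ S'0; rewrite !inE => /andP[yx yS].
rewrite eq_sym in yx; have [f0 vf0] := ex_edge yx.
have Pf0 : (val f0 \subset S) && (x \in val f0).
  by rewrite vf0 !inE eqxx andbT finset.subUset !finset.sub1set xS yS.
(* The lightest edge that joins x to another point of S. *)
have [e0 /andP[e0S xe0] e0min] :=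
  @arg_minP _ _ _ f0 (fun e => (val e \subset S) && (x \in val e)) w Pf0.
have [z ve0] := edge_other_end xe0.
have zS : z \in S by apply: (fintype.subsetP e0S); rewrite ve0 !inE eqxx orbT.
exists (w e0 :: L') => [|e eS]; first by rewrite cardS -cardS' /= ltnS.
have [xe|xe] := boolP (x \in val e); last first.
  by rewrite inE memL' ?orbT // finset.subsetD1 eS.
have le0 : w e0 <= w e by apply: e0min; rewrite eS.
have [t ve] := edge_other_end xe.
have tS : t \in S by apply: (fintype.subsetP eS); rewrite ve !inE eqxx orbT.
have [zt|zt] := eqVneq z t.
  by have -> : e = e0; rewrite ?mem_head //; apply: val_inj; rewrite /= ve ve0 zt.
have [f vf] := ex_edge zt.
have fS : val f \subset (S :\ x)%SET.
  rewrite vf finset.subUset !finset.sub1set !inE zS tS !andbT.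
  by rewrite eq_sym (edge_neq ve0) eq_sym (edge_neq ve).
have vf' : val f = [set t; z]%SET by rewrite vf finset.setUC.
have ve0' : val e0 = [set z; x]%SET by rewrite ve0 finset.setUC.
have := um _ _ _ _ _ _ ve0 vf ve; have := um _ _ _ _ _ _ ve0' ve vf.
rewrite (max_idPr le0) => fe; rewrite le_max => /orP[ee0|ef].
  by have -> : w e = w e0; rewrite ?mem_head //; apply/eqP; rewrite eq_le ee0.
have -> : w e = w f by apply/eqP; rewrite eq_le ef.
by rewrite inE memL' ?orbT.
Qed.

End Ultrametrics.

(** * Dimension of a fine cell *)

Section CellDimension.
Variables (R : realType) (E : finType).
Implicit Types (w g : {ffun E -> R^o}) (c : set {ffun E -> R^o}) (e f : E).

Lemma cell_dim_leq c m :
  (forall k (s : k.-tuple {ffun E -> R^o}),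
     free s -> (forall g, g \in s -> c g) -> (k <= m)%N) ->
  (cell_dim c <= m.-1)%N.
Proof.
move=> bound; rewrite /cell_dim -!subn1 leq_sub2r //.
by apply/bigmax_leqP => k /asboolP[s [s_free sc]]; apply: (bound k s).
Qed.

Lemma leq_cell_dim c k (s : k.-tuple {ffun E -> R^o}) :
  free s -> (forall g, g \in s -> c g) -> (k.-1 <= cell_dim c)%N.
Proof.
move=> s_free sc; rewrite /cell_dim -!subn1 leq_sub2r //.
have k_dim : (k < (\dim {: {ffun E -> R^o}}).+1)%N.
  by rewrite ltnS -(size_tuple s) -(eqnP s_free) dimvS // subvf.
apply: (bigop.bigmax_sup (Ordinal k_dim)) => //.
by apply/asboolP; exists s.
Qed.

Definition level_indicators w : seq {ffun E -> R^o} :=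
  [seq [ffun e => (w e == v)%:R] | v <- values w].

Lemma mem_span_level_indicators w g :
  (forall e f, w e = w f -> g e = g f) -> g \in <<level_indicators w>>%VS.
Proof.
move=> wg; pose a v := if [pick e | w e == v] is Some e then g e else 0.
have -> : g = \sum_(v <- values w) a v *: [ffun e => (w e == v)%:R : R^o].
  apply/ffunP => e; rewrite sum_ffunE.
  rewrite (bigD1_seq (w e)) ?values_uniq ?mem_values ?codom_f //=.
  rewrite big1 => [|v]; last by rewrite !ffunE eq_sym => /negbTE->; rewrite scaler0.
  rewrite !ffunE eqxx addr0 [_ *: _]mulr1 /a.
  by case: pickP => [f /eqP/wg->//|/(_ e)]; rewrite eqxx.
rewrite big_seq_cond; apply: memv_suml => v /andP[vw _].
by apply/memvZ/memv_span; apply: map_f.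
Qed.

(** The points of the cell are combinations of the indicators of the level
    sets of [w]. Independent points of the cell remain independent when the
    constant function is added, since all of them sum to zero and it does not.
    So there are fewer of them than level sets. *)
Lemma cell_dim_same_order w c (e0 : E) :
  (forall g, c g -> same_order w g /\ \sum_e g e = 0) ->
  (cell_dim c <= (size (values w)).-2)%N.
Proof.
move=> cw; apply: cell_dim_leq => k s s_free sc.
pose one : {ffun E -> R^o} := [ffun => 1].
(* Points of the cell sum to zero, unlike the constant function one. *)
have one_notin : one \notin <<s>>%VS.
  apply/negP => /coord_span one_eq.
  have : \sum_e one e = 0.
    rewrite one_eq; under eq_bigr => e _ do rewrite sum_ffunE.
    rewrite exchange_big big1 //= => i _.
    under eq_bigr => e _ do rewrite ffunE.
    rewrite -scaler_sumr; have [|_ ->] := cw s`_i; last by rewrite scaler0.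
    by apply/sc/mem_nth; rewrite size_tuple.
  under eq_bigr => e _ do rewrite ffunE.
  move/eqP; rewrite sumr_const pnatr_eq0 -leqn0 leqNgt.
  by move=> /negP; apply; apply/card_gt0P; exists e0.
have one_free : free (one :: s) by rewrite free_cons one_notin.
have sub : (<<one :: s>> <= <<level_indicators w>>)%VS.
  apply/span_subvP => g; rewrite inE => /predU1P[->|gs].
    by apply: mem_span_level_indicators => e f _; rewrite !ffunE.
  have [wg _] := cw g (sc g gs); apply: mem_span_level_indicators => e f wef.
  by apply/eqP; rewrite eq_le -!wg wef lexx.
have := leq_trans (dimvS sub) (dim_span _).
rewrite (eqnP one_free) /= size_tuple size_map.
by case: (size _).
Qed.

(** A nonconstant weight has a unique positive affine image on the sphere; such
    an image orders the edges in the same way. *)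
Lemma normalize g e f : g e != g f ->
  exists a b, [/\ 0 < a, \sum_e (a * (g e - b)) = 0 &
    \sum_e (a * (g e - b)) ^+ 2 = 1 :> R].
Proof.
move=> gef; pose b : R := (\sum_e g e) / #|E|%:R.
pose q : R := \sum_e (g e - b) ^+ 2.
have sum0 : \sum_e (g e - b) = 0.
  rewrite big_split /= sumr_const /b -mulNr -[X in _ + X]mulr_natr mulfVK ?subrr //.
  by rewrite pnatr_eq0 -lt0n; apply/card_gt0P; exists e.
have q0 : 0 <= q by apply: sumr_ge0 => h _; rewrite sqr_ge0.
have q_gt0 : 0 < q.
  rewrite lt_neqAle q0 andbT eq_sym; apply: contra gef => /eqP/psumr_eq0P gb.
  have gb0 h : g h = b.
    apply/eqP; rewrite -subr_eq0 -sqrf_eq0; apply/eqP/gb => // i _.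
    exact: sqr_ge0.
  by rewrite !gb0.
exists (Num.sqrt q)^-1, b; split.
- by rewrite invr_gt0 sqrtr_gt0.
- by rewrite -mulr_sumr sum0 mulr0.
under eq_bigr => h _ do rewrite exprMn.
by rewrite -mulr_sumr exprVn sqr_sqrtr // mulVf // gt_eqF.
Qed.

End CellDimension.

(** * Ancestors and lowest common ancestors *)

Section TreeOrder.
Variables (n : nat) (t : labeled_tree n).
Implicit Types (u v x y z : t) (i j : 'I_n).
Local Notation root := (tree_root t).
Local Notation par := (@parent n t).
Local Notation below := (fconnect (@parent n t)).

Lemma iter_parent_root k : iter k par root = root.
Proof. by elim: k => //= k ->; rewrite parent_root. Qed.

Lemma belowP u v : reflect (exists k, iter k par u = v) (below u v).
Proof.
apply: (iffP idP) => [uv|[k <-]]; last exact: fconnect_iter.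
by exists (findex par u v); apply: iter_findex.
Qed.

Lemma below_root u : below u root.
Proof. by apply/belowP; apply: root_ancestor. Qed.

Lemma root_below v : below root v -> v = root.
Proof. by case/belowP => k <-; rewrite iter_parent_root. Qed.

Lemma below_trans : transitive below.
Proof. exact: connect_trans. Qed.

(** A vertex on a cycle of [parent] would never reach the root, unless it is
    the root. *)
Lemma below_anti : antisymmetric below.
Proof.
move=> u v /andP[/belowP[k uv] /belowP[l vu]].
case: k uv => [//|k] uv.
(* The loop can be followed longer than the distance of u to the root. *)
have loop m : iter (m * (l + k.+1)) par u = u.
  by elim: m => // m IHm; rewrite mulSn iterD IHm iterD uv vu.
have [m um] := root_ancestor u.
have u_root : u = root.
  rewrite -(loop m); have m_le : (m <= m * (l + k.+1))%N.
    by rewrite leq_pmulr // addnS.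
  by rewrite -(subnK m_le) iterD um iter_parent_root.
by rewrite -uv u_root iter_parent_root.
Qed.

Lemma below_chain u v w : below u v -> below u w -> below v w || below w v.
Proof.
case/belowP => k <- /belowP[l <-].
have [kl|/ltnW lk] := leqP k l.
  by rewrite -(subnK kl) iterD fconnect_iter.
by rewrite -(subnK lk) iterD fconnect_iter orbT.
Qed.

Lemma below_parent u v : below u v -> u != v -> below (par u) v.
Proof.
case/belowP => -[|k] <-; first by rewrite eqxx.
by rewrite iterSr fconnect_iter.
Qed.

Lemma parent_neq v : v != root -> par v != v.
Proof.
apply: contra => /eqP pv; have [k <-] := root_ancestor v.
by elim: k => //= k /eqP <-; rewrite pv.
Qed.

Lemma root_induction (P : t -> Prop) :
  P root -> (forall v, v != root -> P (par v) -> P v) -> forall v, P v.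
Proof.
move=> P0 PS v; have [k] := root_ancestor v.
elim: k v => [v /= ->//|k IHk v]; rewrite iterSr => /IHk Pv.
by have [->//|/PS] := eqVneq v root; apply.
Qed.

(** If [leaf i] is the parent of some vertex other than the root, it has a
    child; the only other case is that of the root, which is its own parent. *)
Lemma below_leaf u i : below u (leaf t i) -> u = leaf t i.
Proof.
case/belowP => k; elim: k u => //= k IHk u ui.
have [uroot|uroot] := eqVneq (iter k par u) root.
  by apply: IHk; rewrite -ui uroot parent_root.
have : children root par (leaf t i) == finset.set0 by rewrite leafP codom_f.
by move=> /eqP/setP/(_ (iter k par u)); rewrite !inE uroot ui eqxx.
Qed.

Lemma internal_below u v : below u v -> internal u -> internal v.
Proof.
move=> uv; apply: contra => /codomP[i vi].
by rewrite vi in uv; rewrite (below_leaf uv) codom_f.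
Qed.

Lemma ex_leaf_below v : exists i, below (leaf t i) v.
Proof.
move: {2}#|[set u | below u v]%SET|.+1 (ltnSn #|[set u | below u v]%SET|) => m.
elim: m v => // m IHm v; rewrite ltnS => vm.
have [/codomP[i ->]|] := boolP (v \in codom (@leaf n t)); first by exists i.
rewrite -leafP => /set0Pn[u]; rewrite inE => /andP[uroot /eqP uv].
have u_below : below u v by rewrite -uv fconnect1.
have [|i iu] := IHm u; last by exists i; apply: below_trans u_below.
apply: leq_trans vm; apply: proper_card; apply/properP; split.
  by apply/fintype.subsetP => x; rewrite !inE => /below_trans; apply.
exists v; rewrite inE ?connect0 //; apply/negP => vu.
have := parent_neq uroot; rewrite uv => /eqP; apply.
by apply: below_anti; rewrite vu u_below.
Qed.

Lemma below_child u v : below u v -> u != v ->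
  exists x, [/\ x != root, par x = v & below u x].
Proof.
case/belowP => k; elim: k u => [u /= ->|k IHk u]; first by rewrite eqxx.
rewrite iterSr => uv neq; have [puv|puv] := eqVneq (par u) v.
  exists u; split=> //; apply: contraNneq neq => ur.
  by rewrite -puv ur parent_root.
have [x [xroot xv ux]] := IHk _ uv puv; exists x; split=> //.
exact: connect_trans (fconnect1 _ _) ux.
Qed.

(** Two vertices with a common descendant are comparable, and distinct
    siblings are not. *)
Lemma sibling_below u x y : x != root -> y != root -> par x = par y ->
  below u x -> below u y -> x = y.
Proof.
move=> xroot yroot pxy ux uy; wlog xy : x y xroot yroot pxy ux uy / below x y.
  move=> H; case/orP: (below_chain ux uy) => ?; first exact: H.
  exact/esym/H.
apply/eqP; apply: contraT => /(below_parent xy) pxy'.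
case/negP: (parent_neq yroot); apply/eqP/below_anti.
by rewrite -{1}pxy pxy' fconnect1.
Qed.

Definition above (e : edge n) v : bool := [forall i in val e, below (leaf t i) v].

(** Among the common ancestors of the ends of [e], which form a chain, the one
    with the fewest descendants. The default [root] is itself a common ancestor. *)
Definition lca (e : edge n) : t :=
  [arg min_(v < root | above e v) #|[set u | below u v]%SET|].

Lemma aboveP e v i j : val e = [set i; j]%SET ->
  above e v = below (leaf t i) v && below (leaf t j) v.
Proof.
move=> ve; apply/forall_inP/andP => [ab|[iv jv] k].
  by split; apply: ab; rewrite ve !inE eqxx ?orbT.
by rewrite ve => /set2P[]->.
Qed.

Lemma lcaP e : above e (lca e) /\ forall v, above e v -> below (lca e) v.
Proof.
have [i [j ve]] := edge_ends e; rewrite /lca; case: arg_minnP.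
  by rewrite (aboveP _ ve) !below_root.
move=> a ea amin; split=> // v ev; have := amin v ev; move: ea ev.
rewrite !(aboveP _ ve) => /andP[ia _] /andP[iv _] le_card.
case/orP: (below_chain ia iv) => // va.
have sub : [set u | below u v]%SET \subset [set u | below u a]%SET.
  by apply/fintype.subsetP => x; rewrite !inE => /below_trans; apply.
have /setP/(_ a) : [set u | below u v]%SET = [set u | below u a]%SET.
  by apply/eqP; rewrite eqEcard sub.
by rewrite !inE connect0.
Qed.

Lemma lca_internal e : internal (lca e).
Proof.
apply/negP => /codomP[k ek]; have [i [j ve]] := edge_ends e.
have [] := lcaP e; rewrite (aboveP _ ve) ek => /andP[/below_leaf ik /below_leaf jk] _.
by have /eqP := edge_neq ve; apply; apply: (@leaf_inj _ t); rewrite ik jk.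
Qed.

(** Join a leaf below one child of [v] to a leaf below another child. *)
Lemma lca_surj v : internal v -> exists e, lca e = v.
Proof.
move=> v_int; have /card_gt1P[x [y []]] := branching v_int.
rewrite !inE => /andP[xroot /eqP xv] /andP[yroot /eqP yv] xy.
have [[i ix] [j jy]] := (ex_leaf_below x, ex_leaf_below y).
have disj u : below u x -> below u y -> False.
  by move=> ux uy; move/eqP: xy; apply; apply: sibling_below ux uy; rewrite ?yv.
(* No leaf lies below both children, so the leaves i and j are distinct. *)
have ij : i != j by apply: contraPneq jy => <- /(disj _ ix).
have [e ve] := ex_edge ij; exists e.
have ev : above e v.
  rewrite (aboveP _ ve) -{1}xv -yv.
  by rewrite (connect_trans ix (fconnect1 _ _)) (connect_trans jy (fconnect1 _ _)).
have [el lmin] := lcaP e; apply/eqP; apply: contraT => neq.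
have [z [zroot zv lz]] := below_child (lmin _ ev) neq.
move: el; rewrite (aboveP _ ve) => /andP[il jl].
have iz : x = z by apply: sibling_below ix (connect_trans il lz); rewrite ?zv.
have jz : y = z by apply: sibling_below jy (connect_trans jl lz); rewrite ?zv.
by rewrite iz jz eqxx in xy.
Qed.

(** Combinatorial form of the strong triangle inequality: [lca e1] and [lca e2]
    are both above [j], and the higher of the two is above [i] and [k]. *)
Lemma lca_triangle i j k (e1 e2 e3 : edge n) :
  val e1 = [set i; j]%SET -> val e2 = [set j; k]%SET -> val e3 = [set i; k]%SET ->
  below (lca e3) (lca e1) || below (lca e3) (lca e2).
Proof.
move=> v1 v2 v3; have [[a1 _] [a2 _]] := (lcaP e1, lcaP e2).
have [_ min3] := lcaP e3; move: a1 a2.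
rewrite (aboveP _ v1) (aboveP _ v2) => /andP[i1 j1] /andP[j2 k2].
case/orP: (below_chain j1 j2) => [l12|l21]; apply/orP; [right|left]; apply: min3;
  rewrite (aboveP _ v3).
  by rewrite (connect_trans i1 l12).
by rewrite i1 (connect_trans k2 l21).
Qed.

(** Count the vertices other than the root, once by their parents and once as
    internal vertices and leaves. *)
Lemma card_internal : binary t -> (0 < n)%N -> #|[set v : t | internal v]%SET| = n.-1.
Proof.
move=> t_bin n_gt0.
have leaves : #|[set v : t | ~~ internal v]%SET| = n.
  rewrite -[RHS]card_ord -(card_codom (@leaf_inj _ t)).
  by apply: eq_card => v; rewrite !inE negbK.
have total := cardsC [set v : t | internal v]%SET.
have compl : (~: [set v : t | internal v] = [set v : t | ~~ internal v])%SET.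
  by apply/setP => v; rewrite !inE.
rewrite compl leaves in total.
have : (\sum_(v : t) #|children root par v| = #|[set u : t | u != root]%SET|)%N.
  rewrite -[RHS]sum1_card [RHS](partition_big par predT) //=.
  by apply: eq_bigr => v _; rewrite -sum1_card; apply: eq_bigl => u; rewrite !inE.
rewrite (bigID (@internal n t)) /= [X in (_ + X)%N]big1 => [|v].
  rewrite addn0 (eq_bigr (fun=> 2%N)) => [|v vi]; last exact: t_bin.
  rewrite (eq_bigl (mem [set v : t | internal v]%SET)) => [|v]; last by rewrite !inE.
  have -> : [set u : t | u != root]%SET = [set~ root]%SET.
    by apply/setP => v; rewrite !inE.
  rewrite sum_nat_const cardsC1 -total muln2 -addnn.
  by rewrite -subn1 -addnBA // subn1 => /addnI.
by rewrite /internal negbK -leafP => /eqP->; rewrite cards0.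
Qed.

End TreeOrder.

(** * Path lengths and the points of C(tau) *)

Section TreeDistances.
Variables (n : nat) (t : labeled_tree n) (R : realType).
Implicit Types (u v x y z a : t) (p : seq t).
Local Notation root := (tree_root t).
Local Notation par := (@parent n t).
Local Notation below := (fconnect (@parent n t)).

Section FixedLengths.
Variable len : t -> R.

Definition root_dist v : R := \sum_(u | below v u && (u != root)) len u.

Lemma root_dist_root : root_dist root = 0.
Proof. by apply: big1 => u /andP[/root_below->]; rewrite eqxx. Qed.

Lemma root_dist_parent v : v != root ->
  root_dist v = len v + root_dist (par v).
Proof.
move=> vroot; rewrite /root_dist (bigD1 v) ?connect0 //=; congr (_ + _).
apply: eq_bigl => u; rewrite andbAC; congr (_ && _).
apply/andP/idP => [[vu uv]|pvu]; first by rewrite below_parent // eq_sym.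
split; first exact: connect_trans (fconnect1 _ _) pvu.
apply: contraNneq (parent_neq vroot) => uv; apply/eqP/below_anti.
by move: pvu; rewrite uv => ->; rewrite fconnect1.
Qed.

Lemma adjacent_parent_neq x y : adjacent x y -> par x = y -> x != root.
Proof.
by move=> /andP[xy _] pxy; apply: contraNneq xy => xr; rewrite -pxy xr parent_root.
Qed.

Lemma edge_length_up x y : adjacent x y -> par x = y ->
  edge_length len x y = root_dist x - root_dist y.
Proof.
move=> xy pxy; rewrite /edge_length pxy eqxx root_dist_parent.
  by rewrite pxy addrK.
exact: adjacent_parent_neq pxy.
Qed.

Lemma edge_length_down x y : adjacent x y -> par y = x ->
  edge_length len x y = root_dist y - root_dist x.
Proof.
move=> xy pyx; have [neq _] := andP xy.
have yroot : y != root by apply: contraNneq neq => yr; rewrite -pyx yr parent_root.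
rewrite /edge_length root_dist_parent // pyx addrK.
case: eqP => // pxy; case/eqP: neq; apply: below_anti.
apply/andP; split; first by rewrite -pxy fconnect1.
by rewrite -pyx fconnect1.
Qed.

(** Once a simple path goes down it cannot turn up again, as the only way up
    leads back to the vertex it comes from. Its length telescopes, and it meets
    every vertex between its ends. *)
Lemma path_down y p : path (@adjacent n t) y p -> uniq (par y :: y :: p) ->
  [/\ below (last y p) y,
      path_length len y p = root_dist (last y p) - root_dist y &
      forall u, below (last y p) u -> below u y -> u \in y :: p].
Proof.
elim: p y => [|z p IHp] y /=.
  split; rewrite ?subrr // => u yu uy; rewrite inE; apply/eqP/below_anti.
  by rewrite uy yu.
move=> /andP[yz pth] uniq_yzp; have pzy : par z = y.
  case/andP: (yz) => _ /orP[]/eqP // pyz.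
  by move: uniq_yzp; rewrite pyz !inE eqxx orbT.
have [|below_z len_z mem_z] := IHp z pth; first by rewrite pzy; case/andP: uniq_yzp.
split.
- by apply: connect_trans below_z _; rewrite -pzy fconnect1.
- by rewrite len_z edge_length_down // addrC addrA subrK.
move=> u lu uy; case/orP: (below_chain lu below_z) => [uz|zu].
  by rewrite inE mem_z ?orbT.
have [zu_eq|zu_neq] := eqVneq z u; first by rewrite -zu_eq !inE eqxx orbT.
have yu : below y u by rewrite -pzy below_parent.
have -> : u = y by apply: below_anti; rewrite uy yu.
exact: mem_head.
Qed.

(** Lowest common ancestor of two arbitrary vertices, as a relation. *)
Definition is_meet x y a : Prop :=
  [/\ below x a, below y a & forall b, below x b -> below y b -> below a b].

(** A simple path goes up from [x] to some [a] and then down. That [a] is the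
    lowest common ancestor uses simplicity: a lower one would be visited both
    on the way up and on the way down. The last clause, on the vertices of the
    descending part, carries this through the induction. *)
Lemma simple_path_length x p : path (@adjacent n t) x p -> uniq (x :: p) ->
  exists a, [/\ is_meet x (last x p) a,
    path_length len x p = root_dist x + root_dist (last x p) - root_dist a *+ 2 &
    forall u, below (last x p) u -> below u a -> u \in x :: p].
Proof.
elim: p x => [|y p IHp] x /=.
  exists x; split=> [||u xu ux]; first by split; rewrite ?connect0.
    by rewrite mulr2n subrr.
  by rewrite inE; apply/eqP/below_anti; rewrite ux xu.
move=> /andP[xy pth] uniq_xyp.
case/andP: (xy) => neq /orP[]/eqP => [pxy|pyx].
  have [|a [[ya la amin] len_y mem_y]] := IHp y pth; first by case/andP: uniq_xyp.
  have x_y : below x y by rewrite -pxy fconnect1.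
  exists a; split; last by move=> u lu ua; rewrite inE mem_y ?orbT.
    split=> [||b xb lb] //; first exact: connect_trans ya.
    have [xb_eq|xb_neq] := eqVneq x b; last by rewrite amin // -pxy below_parent.
    (* Here x is below a = y and above the end of the path, so it is revisited. *)
    have ay : below a y by apply: amin => //; apply: connect_trans lb _; rewrite -xb_eq.
    have a_eq : a = y by apply: below_anti; rewrite ay ya.
    have : x \in y :: p by rewrite mem_y ?a_eq // xb_eq.
    by case/andP: uniq_xyp => /negbTE->.
  by rewrite len_y edge_length_up // !addrA subrK.
have [|ly len_y mem_y] := path_down pth; first by rewrite pyx.
have y_x : below y x by rewrite -pyx fconnect1.
exists x; split.
- by split=> //; apply: connect_trans ly y_x.
- by rewrite len_y edge_length_down //; ring.
move=> u lu ux; case/orP: (below_chain lu ly) => [uy|yu].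
  by rewrite inE mem_y ?orbT.
have [yu_eq|yu_neq] := eqVneq y u; first by rewrite -yu_eq !inE eqxx orbT.
have xu : below x u by rewrite -pyx below_parent.
have -> : u = x by apply: below_anti; rewrite ux xu.
exact: mem_head.
Qed.

Lemma adjacent_sym : symmetric (@adjacent n t).
Proof. by move=> x y; rewrite /adjacent eq_sym orbC. Qed.

Lemma connect_adjacent x y : connect (@adjacent n t) x y.
Proof.
have to_root v : connect (@adjacent n t) v root.
  elim/root_induction: v => // v vroot; apply: connect_trans; apply: connect1.
  by rewrite /adjacent eqxx eq_sym parent_neq.
apply: connect_trans (to_root x) _.
by rewrite (sym_connect_sym adjacent_sym).
Qed.

(** All simple paths from [x] to [y] have the length found above, and there is
    one because the tree is connected. *)
Lemma is_distanceP x y a d : is_meet x y a ->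
  is_distance len x y d <-> d = root_dist x + root_dist y - root_dist a *+ 2.
Proof.
move=> [xa ya amin].
have dist_eq p : path (@adjacent n t) x p -> uniq (x :: p) -> last x p = y ->
    path_length len x p = root_dist x + root_dist y - root_dist a *+ 2.
  move=> pth p_uniq py; have [b [[xb yb bmin] -> _]] := simple_path_length pth p_uniq.
  rewrite py in yb bmin *; suff -> : a = b by [].
  by apply: below_anti; rewrite amin // bmin.
split=> [[p [pth p_uniq py <-]]|->]; first exact: dist_eq.
have /connectP[p pth py] := connect_adjacent x y.
case/shortenP: pth py => p' pth' p'_uniq _ py.
by exists p'; split=> //; apply: dist_eq.
Qed.

Lemma is_meet_root v : is_meet root v root.
Proof. by split; rewrite ?connect0 ?below_root. Qed.

Lemma is_meet_lca (e : edge n) i j : val e = [set i; j]%SET ->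
  is_meet (leaf t i) (leaf t j) (lca t e).
Proof.
move=> ve; have [el lmin] := lcaP t e.
move: el; rewrite (aboveP _ ve) => /andP[il jl]; split=> // b ib jb.
by apply: lmin; rewrite (aboveP _ ve) ib.
Qed.

End FixedLengths.

Definition heights (H : t -> R) : Prop :=
  forall v, v != root -> internal v -> H v < H (par v).

Lemma heights_lt H u v : heights H -> internal u -> below u v -> u != v -> H u < H v.
Proof.
move=> Hinc u_int /belowP[k]; elim: k u u_int => [u _ /= ->|k IHk u u_int].
  by rewrite eqxx.
rewrite iterSr => puv neq; have uroot : u != root.
  by apply: contraNneq neq => ur; rewrite -puv ur parent_root iter_parent_root.
have [<-|neq'] := eqVneq (par u) v; first exact: Hinc.
apply: lt_trans (Hinc u uroot u_int) (IHk _ _ puv neq').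
exact: internal_below (fconnect1 _ _) u_int.
Qed.

(** Put [H v] equal to twice the distance from [v] down to the leaves. Conversely
    the length of the edge above [v] is recovered as half the increment of [H],
    with [H = 0] at the leaves; it is positive for internal [v] because [H]
    increases. *)
Lemma tree_cellP (w : {ffun edge n -> R^o}) :
  tree_cell t R w <-> bergman_complex (graphic_Kn n) w /\
    exists2 H, heights H & forall e, w e = H (lca t e).
Proof.
split=> [[w_berg [len [[len_gt0 [h leaf_dist]] w_dist]]]|[w_berg [H Hinc wH]]].
  split=> //; exists (fun v => (h - root_dist len v) *+ 2) => [v vroot v_int|e].
    rewrite ltrMn2r /= ltrD2l ltrN2 (root_dist_parent len vroot) ltrDr.
    exact: len_gt0.
  have leafE i : root_dist len (leaf t i) = h.
    have /is_distanceP := leaf_dist i; move/(_ root (is_meet_root _)) ->.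
    by rewrite root_dist_root mul0rn subr0 add0r.
  have [i [j ve]] := edge_ends e.
  have /is_distanceP := w_dist e i j ve; move/(_ _ (is_meet_lca ve)) ->.
  by rewrite !leafE mulrnBl mulr2n.
(* Only the values of H at internal vertices matter; leaves get height 0. *)
split=> //; pose H' v := if internal v then H v else 0.
pose len v := (H' (par v) - H' v) / 2.
have rdE v : root_dist len v = (H' root - H' v) / 2.
  elim/root_induction: v => [|v vroot IHv]; first by rewrite root_dist_root subrr mul0r.
  by rewrite root_dist_parent // IHv -mulrDl addrC addrA subrK.
have H'leaf i : H' (leaf t i) = 0 by rewrite /H' /internal codom_f.
exists len; split; [split=> [v vroot v_int|]|].
- rewrite divr_gt0 // subr_gt0 /H' v_int (internal_below (fconnect1 _ _) v_int).
  exact: Hinc.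
- exists (H' root / 2) => i; apply/(is_distanceP _ _ (is_meet_root _)).
  by rewrite root_dist_root mul0rn subr0 add0r rdE H'leaf subr0.
move=> e i j ve; apply/(is_distanceP _ _ (is_meet_lca ve)).
have -> : w e = H' (lca t e) by rewrite wH /H' lca_internal.
by rewrite !rdE !H'leaf; field.
Qed.

End TreeDistances.

(** * Fine cells of linear extensions *)

Section OrderCells.
Variables (R : realType) (n : nat) (t : labeled_tree n).
Hypotheses (n_ge3 : (3 <= n)%N) (t_bin : binary t).
Implicit Types (w g : {ffun edge n -> R^o}) (e f : edge n) (u v : t) (s : seq t).
Local Notation below := (fconnect (@parent n t)).
Local Notation internals := [set v : t | internal v]%SET.
Local Notation linext := (is_linext below internals).

(** The list [s] runs from the root downwards, so weights decrease along it. *)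
Definition ordered_by s w : Prop :=
  forall e f, (w e <= w f) = (index (lca t f) s <= index (lca t e) s)%N.

(** For a linear extension [s] this is a fine cell: see [fine_order_cell]. *)
Definition order_cell s : set {ffun edge n -> R^o} :=
  [set w | bergman_complex (graphic_Kn n) w /\ ordered_by s w].

Lemma ordered_by_inj s w e f : linext s -> ordered_by s w ->
  w e = w f -> lca t e = lca t f.
Proof.
move=> [_ sI _] ws wef.
have lca_in h : lca t h \in s by rewrite sI inE lca_internal.
apply: (index_inj (tree_root t) (s := s)) => //; apply/eqP.
by rewrite eqn_leq -!ws wef lexx.
Qed.

Lemma ordered_by_ultrametric s w : linext s -> ordered_by s w -> ultrametric w.
Proof.
move=> [_ _ s_le] ws i j k e1 e2 e3 v1 v2 v3; rewrite le_max !ws.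
by case/orP: (lca_triangle t v1 v2 v3) => /s_le->; rewrite ?orbT // !inE lca_internal.
Qed.

Lemma card_internals : #|internals| = n.-1.
Proof. by apply: card_internal => //; apply: leq_trans n_ge3. Qed.

Lemma size_linext s : linext s -> size s = n.-1.
Proof.
by case=> s_uniq sI _; rewrite -card_internals -(card_uniqP s_uniq); apply: eq_card.
Qed.

(** With [n - 1 >= 2] internal vertices a weight ordered by [s] is not constant,
    so it can be moved to the sphere. *)
Lemma order_cell_normalize s g : linext s -> ordered_by s g ->
  exists a b, 0 < a /\ order_cell s [ffun e => a * (g e - b)].
Proof.
move=> s_lin gs; have /card_gt1P[u [v []]] : (1 < #|internals|)%N.
  by rewrite card_internals; case: n n_ge3 => [|[|[]]].
rewrite !inE => /(lca_surj (t := t))[e eu] /(lca_surj (t := t))[f fv] uv.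
have gef : g e != g f.
  by apply: contra uv => /eqP/(ordered_by_inj s_lin gs); rewrite eu fv => ->.
have [a [b [a0 sum0 sum1]]] := normalize gef; exists a, b; split=> //.
have ord : ordered_by s [ffun e => a * (g e - b)].
  by move=> e' f'; rewrite !ffunE ler_pM2l // lerD2r gs.
split=> //; split; first exact/ultrametric_bergman_fan/(ordered_by_ultrametric s_lin).
  by under eq_bigr => h _ do rewrite ffunE.
by under eq_bigr => h _ do rewrite ffunE.
Qed.

Lemma leq_count_jump j a b : (a + (j < a) <= b + (j < b))%N = (a <= b)%N.
Proof.
case: (leqP a b) => ab.
  apply: leq_add => //; case: (ltnP j a) => // ja.
  by rewrite (leq_trans ja ab).
apply/negbTE; rewrite -ltnNge -addSn; apply: leq_add => //.
by case: (ltnP j b) => // jb; rewrite (ltn_trans jb ab).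
Qed.

(** Unit gaps between consecutive vertices of [s], except a gap of 2 after
    position [j]. *)
Definition jump_weight s (j : nat) : {ffun edge n -> R^o} :=
  [ffun e => - (index (lca t e) s + (j < index (lca t e) s))%:R].

Lemma jump_weight_ordered s j : ordered_by s (jump_weight s j).
Proof. by move=> e f; rewrite !ffunE lerN2 ler_nat leq_count_jump. Qed.

Lemma order_cell_point s j : linext s ->
  exists g a, [/\ order_cell s g, 0 < a &
    forall e f, g e - g f = a * (jump_weight s j e - jump_weight s j f)].
Proof.
move=> s_lin; have [a [b [a0 sg]]] := order_cell_normalize s_lin (jump_weight_ordered s j).
exists [ffun e => a * (jump_weight s j e - b)], a; split=> // e f.
by rewrite !ffunE; ring.
Qed.

(** The normalized [jump_weight s j], for [j < n - 2], are independent. In a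
    linear relation with coefficients [c j], the difference of the weights at
    positions [i] and [i + 1] gives [M + m i = 0], where [m j = c j * a j], [a j]
    is the scaling factor of the [j]-th point, and [M] is the sum of the [m j].
    Summing over [i] gives [(n - 1) M = 0], so [M] and all [m i] vanish. *)
Lemma order_cell_dim s : linext s -> ((n.-1).-2 <= cell_dim (order_cell s))%N.
Proof.
move=> s_lin; have [s_uniq sI _] := s_lin; pose k := n.-2.
have [p /choice[a apP]] := choice (fun j : 'I_k => order_cell_point j s_lin).
have pP j : order_cell s (p j) by case: (apP j).
have a_gt0 j : 0 < a j by case: (apP j).
have pE j e f : p j e - p j f = a j * (jump_weight s j e - jump_weight s j f).
  by case: (apP j).
have k1 : k.+1 = size s by rewrite size_linext // /k; case: n n_ge3 => [|[]].
have -> : ((n.-1).-2 = k.-1)%N by [].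
apply: (leq_cell_dim (s := [tuple p j | j < k])) => [|g /mapP[j _ ->]] //.
apply/freeP => c sum_c0.
have nth_edge i : (i < size s)%N -> exists e, lca t e = nth (tree_root t) s i.
  by move=> ilt; apply: lca_surj; have := mem_nth (tree_root t) ilt; rewrite sI inE.
pose M := \sum_j c j * a j.
have jump (i : 'I_k) : M + c i * a i = 0.
  have i1_lt : (i.+1 < size s)%N by rewrite -k1 ltnS.
  have i_lt := ltnW i1_lt; have [[e ei] [f fi]] := (nth_edge _ i_lt, nth_edge _ i1_lt).
  have term (j : 'I_k) :
      c j *: [tuple p j | j < k]`_j e - c j *: [tuple p j | j < k]`_j f
      = c j * a j + c j * a j * (j == i)%:R.
    rewrite -!tnth_nth tnth_mktuple -scalerBr pE !ffunE ei fi.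
    rewrite !index_uniq // ltnS.
    have -> : (j <= i)%N = ((j == i) + (j < i))%N :> nat.
      by rewrite leq_eqVlt -val_eqE /=; case: ltngtP.
    rewrite -natr1 !natrD; have scaleE (x y : R) : x *: (y : R^o) = x * y by [].
    by rewrite scaleE; ring.
  have : (\sum_(j < k) c j *: [tuple p j | j < k]`_j) e
       - (\sum_(j < k) c j *: [tuple p j | j < k]`_j) f = 0.
    by rewrite sum_c0 !ffunE subrr.
  rewrite !sum_ffunE -sumrB => diff0; apply: etrans diff0.
  under [RHS]eq_bigr => j _ do rewrite !ffunE term.
  rewrite big_split /=; congr (_ + _).
  rewrite (bigD1 i) //= eqxx mulr1 big1 ?addr0 // => j /negbTE->.
  by rewrite mulr0.
have M0 : M = 0.
  have : \sum_(i < k) (M + c i * a i) = 0 by apply: big1.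
  rewrite big_split /= sumr_const card_ord -/M -mulrSr => /eqP.
  by rewrite mulrn_eq0 => /eqP.
move=> i; have := jump i; rewrite M0 add0r => /eqP; rewrite mulf_eq0.
by rewrite (gt_eqF (a_gt0 i)) orbF => /eqP.
Qed.

Lemma order_cellE s w : order_cell s w ->
  order_cell s = [set w' | bergman_complex (graphic_Kn n) w' /\ same_flag w w'].
Proof.
move=> [_ ws]; apply/seteqP; split=> w' [w'_berg].
  by move=> w's; split=> //; apply/same_flagP => e f; rewrite ws w's.
by move=> /same_flagP ww'; split=> // e f; rewrite -ww' ws.
Qed.

Lemma order_cell_neq0 s : linext s -> exists w, order_cell s w.
Proof. by move=> s_lin; have [g [_ [sg _ _]]] := order_cell_point 0 s_lin; exists g. Qed.

Lemma fine_order_cell s : linext s -> fine_cell (graphic_Kn n) (order_cell s).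
Proof.
move=> /order_cell_neq0[w sw]; have [w_berg _] := sw.
by exists w => //; apply: order_cellE.
Qed.

(** Any point of the cell of [s] determines how [s] orders the internal
    vertices, since each of them is the [lca] of some edge. *)
Lemma order_cell_inj s s' : linext s -> linext s' ->
  order_cell s = order_cell s' -> s = s'.
Proof.
move=> s_lin s'_lin ss'; have [w sw] := order_cell_neq0 s_lin.
have [_ ws] := sw; have [_ ws'] : order_cell s' w by rewrite -ss'.
have [[s_uniq sI _] [s'_uniq s'I _]] := (s_lin, s'_lin).
have same u v : internal u -> internal v ->
    (index u s < index v s)%N = (index u s' < index v s')%N.
  by move=> /(lca_surj (t := t))[e <-] /(lca_surj (t := t))[f <-]; rewrite !ltnNge -ws ws'.
have index_sorted (q : seq t) : uniq q -> sorted (fun u v => index u q < index v q)%N q.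
  move=> q_uniq; apply/(sortedP (tree_root t)) => i ilt.
  by rewrite !index_uniq // ltnW.
apply: (irr_sorted_eq (leT := fun u v => index u s < index v s)%N).
- by move=> v u x; apply: ltn_trans.
- by move=> u; rewrite ltnn.
- exact: index_sorted.
- have int_s' : all (@internal n t) s' by apply/allP => u; rewrite s'I inE.
  have := index_sorted _ s'_uniq; apply: (sub_in_sorted (P := @internal n t)) => //.
  by move=> u v ui vi; rewrite same.
- by move=> u; rewrite sI s'I.
Qed.

(** On the cell of [s] the weight of an edge depends only on its [lca], and this
    defines [H]. *)
Lemma order_cell_tree_cell s : linext s -> order_cell s `<=` tree_cell t R.
Proof.
move=> s_lin w [w_berg ws]; have [_ sI s_le] := s_lin.
apply/tree_cellP; split=> //.
pose H v : R := if [pick e | lca t e == v] is Some e then w e else 0.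
have wH e : w e = H (lca t e).
  rewrite /H; case: pickP => [f /eqP fe|/(_ e)]; last by rewrite eqxx.
  by apply/eqP; rewrite eq_le !ws fe leqnn.
exists H => // v vroot v_int.
have pv_below : below v (parent v) by exact: fconnect1.
have pv_int := internal_below pv_below v_int.
have [[e ev] [f fv]] := (lca_surj v_int, lca_surj pv_int).
have [-> ->] : H v = w e /\ H (parent v) = w f by rewrite !wH ev fv.
rewrite lt_neqAle ws fv ev s_le ?inE // andbT.
apply: contra (parent_neq vroot) => /eqP/(ordered_by_inj s_lin ws).
by rewrite ev fv => <-.
Qed.

(** At least two values, because a constant weight that sums to zero vanishes
    and is not on the sphere. *)
Lemma bergman_complex_values w : bergman_complex (graphic_Kn n) w ->
  (1 < size (values w) <= n.-1)%N.
Proof.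
move=> [w_berg sum0 sum1]; apply/andP; split.
  rewrite ltnNge; apply/negP => small.
  have w_const e f : w e = w f.
    have lev0 h : level w h = 0%N.
      by have := leq_trans (level_ltn w h) small; rewrite ltnS leqn0 => /eqP.
    by apply/eqP; rewrite eq_le -!level_leq !lev0.
  have w0 e : w e = 0.
    move: sum0; under eq_bigr => f _ do rewrite (w_const f e).
    rewrite sumr_const => /eqP; rewrite mulrn_eq0 => /orP[|/eqP//].
    by rewrite -leqn0 leqNgt => /negP[]; apply/card_gt0P; exists e.
  move: sum1; rewrite big1 => [|e _]; last by rewrite w0 expr0n.
  by move/esym/eqP; rewrite oner_eq0.
have um := bergman_fan_ultrametric w_berg.
have [|L sizeL memL] := @values_bounded R n w [set: 'I_n]%SET um.
  by apply/set0Pn; exists (Ordinal (ltnW (ltnW n_ge3))); rewrite inE.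
rewrite cardsT card_ord in sizeL.
rewrite -ltnS (ltn_predK sizeL); apply: leq_ltn_trans sizeL.
apply: uniq_leq_size (values_uniq w) _ => c; rewrite mem_values => /codomP[e ->].
exact/memL/finset.subsetT.
Qed.

Lemma fine_cell_dim w : bergman_complex (graphic_Kn n) w ->
  (cell_dim [set w' | bergman_complex (graphic_Kn n) w' /\ same_flag w w']
     <= (size (values w)).-2)%N.
Proof.
move=> w_berg; have /andP[w_val _] := bergman_complex_values w_berg.
have [e0 _] := level_surj (ltnW w_val).
apply: cell_dim_same_order e0 _ => g [[_ sum0 _] wg]; split=> //.
exact/same_flagP.
Qed.

Lemma full_dimensional_order_cell s : linext s ->
  full_dimensional (graphic_Kn n) (order_cell s).
Proof.
move=> s_lin _ [w w_berg ->]; apply: leq_trans (order_cell_dim s_lin).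
apply: leq_trans (fine_cell_dim w_berg) _.
have /andP[_] := bergman_complex_values w_berg.
by move=> le; rewrite -!subn2 leq_sub2r.
Qed.

Lemma sort_linext (H : t -> R) : heights H -> {in internals &, injective H} ->
  exists2 s, linext s &
    forall u v, internal u -> internal v ->
      (index v s <= index u s)%N = (H u <= H v).
Proof.
move=> Hinc Hinj; pose ge u v := H v <= H u.
have ge_total : total ge by move=> u v; apply: le_total.
have ge_trans : transitive ge by move=> v u x uv vx; apply: le_trans vx uv.
have ge_refl : reflexive ge by move=> u; apply: lexx.
pose s := sort ge (enum internals).
have sI : s =i internals by move=> u; rewrite mem_sort mem_enum.
have s_sorted : sorted ge s by apply: sort_sorted.
have sE u v : internal u -> internal v -> (index v s <= index u s)%N = (H u <= H v).
  move=> ui vi; have [us vs] : u \in s /\ v \in s by rewrite !sI !inE.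
  apply/idP/idP => [|uv]; first exact: (sorted_leq_index ge_trans ge_refl s_sorted).
  rewrite leqNgt; apply/negP => lt.
  have vu : H v <= H u by apply: (sorted_leq_index ge_trans ge_refl s_sorted) (ltnW lt).
  have uv_eq : u = v.
    by apply: Hinj; rewrite ?inE //; apply/eqP; rewrite eq_le uv vu.
  by rewrite uv_eq ltnn in lt.
exists s => //; split=> //; first by rewrite sort_uniq enum_uniq.
move=> u v; rewrite !inE => ui vi uv; rewrite sE //.
have [->//|neq] := eqVneq u v.
exact/ltW/(heights_lt Hinc).
Qed.

(** Comparing [c] with the cell of a linear extension shows that its weights take
    [n - 1] values, which is the number of internal vertices; so [H] is
    injective, and sorting the internal vertices by decreasing [H] gives [s]. *)
Lemma ex_order_cell c : (exists s, linext s) ->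
  fine_cell (graphic_Kn n) c -> full_dimensional (graphic_Kn n) c ->
  c `<=` tree_cell t R -> exists2 s, linext s & c = order_cell s.
Proof.
move=> [s0 s0_lin] [w w_berg ->] c_full c_tree.
have [|_ [H Hinc wH]] := (tree_cellP t w).1 _.
  by apply: c_tree; split=> //; apply/same_flagP.
have /andP[val_gt1 val_le] := bergman_complex_values w_berg.
have val_ge : (#|internals| <= size (values w))%N.
  have := leq_trans (order_cell_dim s0_lin) (c_full _ (fine_order_cell s0_lin)).
  move=> /leq_trans/(_ (fine_cell_dim w_berg)); rewrite card_internals -!subn2.
  by rewrite leq_subLR subnKC.
(* At least as many values of w as internal vertices: none are repeated. *)
have Hinj : {in internals &, injective H}.
  apply/dinjectiveP; apply: leq_size_uniq (values_uniq w) _ _.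
    move=> c0; rewrite mem_values => /codomP[e ->]; rewrite wH; apply: map_f.
    by rewrite mem_enum inE lca_internal.
  by rewrite size_map -cardE.
have [s s_lin sE] := sort_linext Hinc Hinj; exists s => //.
apply/esym/order_cellE; split=> // e f.
by rewrite sE ?lca_internal // !wH.
Qed.

End OrderCells.

(** * Counting *)

Theorem proposition7p1 (R : realType) (n : nat) (tau : labeled_tree n)
    (hn : (3 <= n)%N) (htau : binary tau) :
  exists N : nat,
    [set c : set {ffun edge n -> R^o} |
       [/\ fine_cell (graphic_Kn n) c, full_dimensional (graphic_Kn n) c &
           c `<=` tree_cell tau R]] #= `I_N /\
    N%:R = (n.-1)`!%:R / \prod_(v : tau | internal v) (num_internal_desc v)%:R
      :> rat.
Proof.
pose le := fconnect (@parent n tau); pose I := [set v : tau | internal v]%SET.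
have le_refl : reflexive le := @connect0 _ _.
have le_anti : antisymmetric le := @below_anti n tau.
have le_trans : transitive le := @below_trans n tau.
have le_chain := @below_chain n tau.
pose L := linexts le #|I| I.
have LP s : s \in L <-> is_linext le I s := linextsP le s erefl.
have hook : (size L * \prod_(v : tau | internal v) num_internal_desc v = (n.-1)`!)%N.
  rewrite -(card_internals hn htau) -(size_linexts le_refl le_anti le_trans le_chain).
  congr (_ * _)%N; apply: eq_big => v; first by rewrite inE.
  by move=> _; apply: eq_card => u; rewrite !inE.
have L_gt0 : (0 < size L)%N.
  by move: (fact_gt0 n.-1); rewrite -hook muln_gt0 => /andP[].
have mem_L i : (i < size L)%N -> is_linext le I (nth [::] L i).
  by move=> ilt; apply/LP/mem_nth.
exists (size L); split.
  pose cell i : set {ffun edge n -> R^o} := order_cell (nth [::] L i).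
  have -> : [set c : set {ffun edge n -> R^o} |
       [/\ fine_cell (graphic_Kn n) c, full_dimensional (graphic_Kn n) c &
           c `<=` tree_cell tau R]] = cell @` `I_(size L).
    apply/seteqP; split=> [c [c_fine c_full c_tree]|_ [i /= ilt <-]].
      have [|s /LP sL ->] := ex_order_cell hn htau _ c_fine c_full c_tree.
        by exists (nth [::] L 0); apply: mem_L.
      by exists (index s L); rewrite /cell /= ?index_mem // nth_index.
    split; first exact: (fine_order_cell _ hn htau (mem_L i ilt)).
      exact: (full_dimensional_order_cell hn htau (mem_L i ilt)).
    exact: (order_cell_tree_cell (mem_L i ilt)).
  apply: inj_card_eq => i j; rewrite !inE /= => ilt jlt.
  move=> /(order_cell_inj hn htau (mem_L i ilt) (mem_L j jlt)) /eqP.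
  by rewrite nth_uniq ?uniq_linexts // => /eqP.
rewrite -hook natrM natr_prod mulfK //.
rewrite prodf_seq_neq0; apply/allP => v _; apply/implyP => v_int.
rewrite pnatr_eq0 -lt0n; apply/card_gt0P; exists v.
by rewrite inE v_int /descendant connect0.
Qed.
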